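(* Let $k\ge 3$ be an integer and let $G$ be a connected graph with $n$ vertices and cyclomatic number $k$. (1) If $n\ge 2k-1$, then $R(G)\le \frac{1}{2}n-\frac{5-2\sqrt{6}}{6}$, with equality if and only if $G\in\Lambda_k^1(n)$. (2) If $n=2k-2$, then $R(G)\le\frac{1}{2}n$, with equality if and only if $G$ is $3$-regular.
   Context: All graphs are finite, simple and undirected. A connected graph with $n$ vertices has cyclomatic number $k$ if it has $n+k-1$ edges. The Randić index is $R(G)=\sum_{uv\in E(G)}\frac{1}{\sqrt{\deg_G(u)\deg_G(v)}}$. $m_{i,j}(G)$ denotes the number of edges joining a vertex of degree $i$ to a vertex of degree $j$. $\Lambda_k^1(n)$ is the set of $n$-vertex graphs $G$ with $m_{3,3}(G)=3k-4$, $m_{2,3}(G)=2$ and $m_{2,2}(G)=n-(2k-1)$. *)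

(* Defs.v *)
From mathcomp Require Import all_boot all_order all_algebra.

Set Implicit Arguments.
Unset Strict Implicit.
Unset Printing Implicit Defensive.

Import Order.TTheory GRing.Theory Num.Theory.
Local Open Scope ring_scope.

Record sgraph := SGraph {
  vertex :> finType;
  adj : rel vertex;
  adj_sym : symmetric adj;
  adj_irr : irreflexive adj
}.

Definition connected_graph (G : sgraph) : Prop :=
  (0 < #|G|)%N /\ forall u v : G, connect (@adj G) u v.

Definition degree (G : sgraph) (u : G) : nat := #|[set v : G | adj u v]|.

(* An undirected edge uv is the two-element set [set u; v]. *)
Definition edges (G : sgraph) : {set {set G}} :=
  [set e : {set G} | [exists u : G, exists v : G, adj u v && (e == [set u; v])]].

(* Stated in int because truncated subtraction would identify the values of
   n + k - 1 at n + k = 0 and n + k = 1. *)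
Definition has_cyclomatic_number (G : sgraph) (k : nat) : Prop :=
  #|edges G|%:Z = #|G|%:Z + k%:Z - 1.

(* For an edge e = [set u; v] one has u != v, so the inner product is
   deg u * deg v. *)
Definition randic (R : rcfType) (G : sgraph) : R :=
  \sum_(e in edges G) 1 / Num.sqrt (\prod_(u in e) (degree u)%:R).

Definition edge_count (G : sgraph) (i j : nat) : nat :=
  #|[set e in edges G | [exists u : G, exists v : G,
      [&& e == [set u; v], degree u == i & degree v == j]]]|.

(* The subtractions are those of int, hence not truncated. *)
Definition Lambda1 (k n : nat) (G : sgraph) : Prop :=
  [/\ #|G| = n,
      (edge_count G 3 3)%:Z = 3 * k%:Z - 4,
      (edge_count G 2 3)%:Z = 2 &
      (edge_count G 2 2)%:Z = n%:Z - (2 * k%:Z - 1)].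

Definition regular (G : sgraph) (d : nat) : Prop :=
  forall u : G, degree u = d.

(* Main.v *)
(** Summing over arcs (ordered pairs of adjacent vertices) gives
    R(G) = n/2 - D/4, where D sums (1/sqrt(deg u) - 1/sqrt(deg v))^2; this
    settles the case n = 2k-2.  If n >= 2k-1, the average degree lies strictly
    between 2 and 3, and D >= 4q must be shown, where q is the term of a (2,3)
    edge.  With a leaf present, some edge joins degree 1 to degree at least 2,
    and 3/2 - sqrt 2 > 4q.  Otherwise the number of edges between the vertices
    of degree 2 and the others is positive, and even because the vertices of
    degree 2 have an even degree sum, so there are at least two of them and each
    contributes at least 2q to D.  Equality forces all degrees to be 2 or 3, and
    then counting determines the edge counts. *)
Require Import Defs.
From mathcomp Require Import all_boot all_order all_algebra.
From mathcomp Require Import zify ring lra.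
Import Order.TTheory GRing.Theory Num.Theory.
Local Open Scope ring_scope.

Set Implicit Arguments.
Unset Strict Implicit.
Unset Printing Implicit Defensive.

(** * Edges and sums over arcs *)

Lemma edge_setP (G : sgraph) (e : {set G}) :
  reflect (exists u v : G, adj u v /\ e = [set u; v]) (e \in edges G).
Proof.
rewrite inE; apply: (iffP existsP) => [[u /existsP [v /andP [uv /eqP ->]]]|].
  by exists u, v.
by case=> u [v [uv ->]]; exists u; apply/existsP; exists v; rewrite uv eqxx.
Qed.

Lemma adj_neq (G : sgraph) (u v : G) : adj u v -> u != v.
Proof. by apply: contraTneq => ->; rewrite adj_irr. Qed.

Lemma set2_eqP (T : finType) (a b u v : T) : a != b ->
  ([set a; b] == [set u; v]) = ((a, b) == (u, v)) || ((a, b) == (v, u)).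
Proof.
move=> ab; apply/eqP/orP => [e|[/eqP [-> ->]|/eqP [-> ->]] //]; last by rewrite setUC.
have: a \in [set u; v] by rewrite -e !inE eqxx.
have: b \in [set u; v] by rewrite -e !inE eqxx orbT.
rewrite !inE => /orP [] /eqP bE /orP [] /eqP aE; subst a b.
- by rewrite eqxx in ab.
- by right; rewrite eqxx.
- by left; rewrite eqxx.
- by rewrite eqxx in ab.
Qed.

(** The fibre of the map from arcs to edges above [[set u; v]] is [(u, v)] and [(v, u)], two
    distinct arcs because [adj] is irreflexive. *)
Lemma sum_arcs_edges (V : nmodType) (G : sgraph) (F : {set G} -> V) :
  \sum_(p : G * G | adj p.1 p.2) F [set p.1; p.2] = (\sum_(e in edges G) F e) *+ 2.
Proof.
rewrite (partition_big (fun p : G * G => [set p.1; p.2]) (mem (edges G))) /=; last first.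
  by case=> u v /= uv; apply/edge_setP; exists u, v.
rewrite -sumrMnl; apply: eq_bigr => e /edge_setP [u [v [uv ->]]].
have nuv := adj_neq uv.
rewrite (eq_bigr (fun=> F [set u; v])) => [|p /andP [_ /eqP ->] //].
rewrite sumr_const; congr (_ *+ _).
rewrite -[RHS](_ : #|[set (u, v); (v, u)]| = 2); last first.
  by rewrite cards2 xpair_eqE negb_and nuv.
apply: eq_card => -[a b]; rewrite !inE /in_mem /=.
apply/andP/orP => [[ab]|]; first by rewrite (set2_eqP _ _ (adj_neq ab)) => /orP.
by case=> /eqP [-> ->]; rewrite ?(adj_sym v) uv ?eqxx // setUC.
Qed.

Lemma sum_arcs_sym (V : nmodType) (G : sgraph) (F : G -> G -> V) :
  \sum_(p : G * G | adj p.1 p.2) F p.1 p.2 = \sum_(p : G * G | adj p.1 p.2) F p.2 p.1.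
Proof.
rewrite (reindex_inj (h := fun p : G * G => (p.2, p.1))) /=; last first.
  by move=> [a b] [c d] /= [-> ->].
by apply: eq_bigl => -[a b]; rewrite /= adj_sym.
Qed.

Lemma sum_arcs_fst (V : nmodType) (G : sgraph) (F : G -> V) :
  \sum_(p : G * G | adj p.1 p.2) F p.1 = \sum_(u : G) F u *+ degree u.
Proof.
rewrite -(pair_big_dep xpredT (fun u v : G => adj u v) (fun u v => F u)) /=.
by apply: eq_bigr => u _; rewrite sumr_const /degree cardsE.
Qed.

Lemma nat_mulr2n (m : nat) : m *+ 2 = (m * 2)%N.
Proof. by rewrite mulr2n muln2 -addnn. Qed.

Lemma sum_degree (G : sgraph) : (\sum_(u : G) degree u = #|edges G| * 2)%N.
Proof.
have := sum_arcs_edges (fun e : {set G} => 1%N).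
rewrite (sum_arcs_fst (fun=> 1%N)) nat_mulr2n sum1_card => <-.
by apply: eq_bigr => u _; rewrite natn.
Qed.

(** Both orientations of a counted edge satisfy the disjunction. For [i = j] the two disjuncts
    coincide, and the boolean [||] still counts an arc once, so the factor 2 is right there too. *)
Lemma edge_count_arcs (G : sgraph) (i j : nat) :
  (edge_count G i j * 2 = \sum_(p : G * G | adj p.1 p.2)
     ((degree p.1 == i) && (degree p.2 == j) ||
      (degree p.1 == j) && (degree p.2 == i)))%N.
Proof.
pose P (e : {set G}) := [exists u : G, exists v : G,
  [&& e == [set u; v], degree u == i & degree v == j]].
have -> : edge_count G i j = (\sum_(e in edges G) P e)%N.
  rewrite /edge_count -sum1_card big_mkcond /= [RHS]big_mkcond /=.
  by apply: eq_bigr => e _; rewrite [in LHS]inE; case: (e \in _).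
have := sum_arcs_edges (fun e : {set G} => nat_of_bool (P e)).
rewrite nat_mulr2n => <-.
apply: eq_bigr => -[a b] /= ab; congr nat_of_bool.
apply/existsP/orP => [[u /existsP [v /and3P [e /eqP ui /eqP vj]]]|].
  move: e; rewrite (set2_eqP _ _ (adj_neq ab)).
  by case/orP => /eqP [-> ->]; rewrite ui vj !eqxx; [left|right].
case=> /andP [ha hb]; first by exists a; apply/existsP; exists b; rewrite eqxx ha hb.
by exists b; apply/existsP; exists a; rewrite setUC eqxx ha hb.
Qed.

(** * Connectedness *)

Lemma connected_cut (G : sgraph) (P : pred G) (a b : G) :
  connected_graph G -> P a -> ~~ P b -> exists u v : G, [/\ adj u v, P u & ~~ P v].
Proof.
move=> [_ conn] Pa Pb.
case: (boolP [exists u : G, exists v : G, [&& adj u v, P u & ~~ P v]]) => [|none].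
  by case/existsP => u /existsP [v /and3P [uv Pu Pv]]; exists u, v.
have step (x y : G) : adj x y -> P x -> P y.
  move=> xy Px; apply: contraR none => Py.
  by apply/existsP; exists x; apply/existsP; exists y; rewrite xy Px Py.
(* If no edge leaves [P], then [P] is a union of components and contains [b] along with [a]. *)
have cl : closed (@adj G) P.
  by move=> x y xy; apply/idP/idP; apply: step; rewrite // adj_sym.
by have := closed_connect cl (conn a b); rewrite /in_mem /= Pa => PbT; rewrite -PbT in Pb.
Qed.

Lemma connected_invariant (G : sgraph) (P : pred G) (a : G) :
  connected_graph G -> (forall u v : G, adj u v -> P u -> P v) -> P a -> forall b, P b.
Proof.
move=> conn step Pa b; apply: contraT => Pb.
have [u [v [uv Pu /negP []]]] := connected_cut conn Pa Pb.
exact: step uv Pu.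
Qed.

Lemma connected_degree_gt0 (G : sgraph) (u : G) :
  connected_graph G -> (1 < #|G|)%N -> (0 < degree u)%N.
Proof.
move=> conn /card_gt1P [x [y [_ _ xy]]].
have [b bu] : exists b : G, b != u.
  by case: (eqVneq x u) => [<-|]; [exists y; rewrite eq_sym|exists x].
have [w [v [wv /eqP wu _]]] := connected_cut (P := pred1 u) conn (eqxx u) bu.
by rewrite -wu card_gt0; apply/set0Pn; exists v; rewrite inE.
Qed.

(** * The deficit of an edge *)

Section RandicDeficit.

Variable R : rcfType.

Definition inv_sqrt (d : nat) : R := (Num.sqrt d%:R)^-1.

(** For positive degrees the square expands to 1/i + 1/j - 2/sqrt(ij), so half of it is what the
    Randić term of an edge lacks from the mean of 1/i and 1/j. *)
Definition deficit (i j : nat) : R := (inv_sqrt i - inv_sqrt j) ^+ 2.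

Lemma inv_sqrt_sqr (d : nat) : inv_sqrt d ^+ 2 = d%:R^-1.
Proof. by rewrite exprVn sqr_sqrtr. Qed.

Lemma ltr_inv_sqrt (i j : nat) : (0 < i < j)%N -> inv_sqrt j < inv_sqrt i.
Proof.
case/andP => i0 ij; have j0 := ltn_trans i0 ij.
by rewrite ltf_pV2 ?qualifE /= ?sqrtr_gt0 ?ltr0n // ltr_sqrt ?ltr0n // ltr_nat.
Qed.

Lemma ler_inv_sqrt (i j : nat) : (0 < i <= j)%N -> inv_sqrt j <= inv_sqrt i.
Proof.
case/andP => i0; rewrite leq_eqVlt => /orP [/eqP -> //|ij].
by apply/ltW/ltr_inv_sqrt; rewrite i0.
Qed.

Lemma inv_sqrt_inj (i j : nat) :
  (0 < i)%N -> (0 < j)%N -> inv_sqrt i = inv_sqrt j -> i = j.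
Proof.
move=> i0 j0 e; case: (ltngtP i j) => // ij.
  by have := @ltr_inv_sqrt i j; rewrite i0 ij e ltxx => /(_ isT).
by have := @ltr_inv_sqrt j i; rewrite j0 ij e ltxx => /(_ isT).
Qed.

Lemma deficit_sym (i j : nat) : deficit i j = deficit j i.
Proof. by rewrite /deficit -sqrrN opprB. Qed.

Lemma deficit_ge0 (i j : nat) : 0 <= deficit i j.
Proof. exact: sqr_ge0. Qed.

Lemma deficitii (i : nat) : deficit i i = 0.
Proof. by rewrite /deficit subrr expr0n. Qed.

Lemma deficit_eq0 (i j : nat) : (0 < i)%N -> (0 < j)%N -> deficit i j = 0 -> i = j.
Proof.
move=> i0 j0 /eqP; rewrite sqrf_eq0 subr_eq0 => /eqP; exact: inv_sqrt_inj.
Qed.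

Lemma ler_deficit (i j l : nat) : (0 < i <= j)%N -> (j <= l)%N -> deficit i j <= deficit i l.
Proof.
case/andP => i0 ij jl.
have h1 : inv_sqrt j <= inv_sqrt i by apply: ler_inv_sqrt; rewrite i0.
have h2 : inv_sqrt l <= inv_sqrt j by apply: ler_inv_sqrt; rewrite (leq_trans i0 ij).
by rewrite ler_sqr ?nnegrE ?subr_ge0 ?(le_trans h2) // lerD2l lerN2.
Qed.

(** On the side [i <= j <= l] both differences of inverse roots are nonnegative, so equal squares
    give equal differences. This serves the equality case, with [i = 2] and [j = 3]. *)
Lemma deficit_inj (i j l : nat) :
  (0 < i <= j)%N -> (j <= l)%N -> deficit i l = deficit i j -> l = j.
Proof.
case/andP => i0 ij jl /eqP.
have h1 : inv_sqrt j <= inv_sqrt i by apply: ler_inv_sqrt; rewrite i0.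
have h2 : inv_sqrt l <= inv_sqrt j by apply: ler_inv_sqrt; rewrite (leq_trans i0 ij).
rewrite eqrXn2 ?subr_ge0 ?(le_trans h2) // => /eqP /addrI /oppr_inj.
by apply: inv_sqrt_inj; lia.
Qed.

Lemma deficit23 : deficit 2 3 = (5 - 2 * Num.sqrt 6) / 6.
Proof.
rewrite /deficit sqrrB !inv_sqrt_sqr /inv_sqrt -invfM -sqrtrM ?ler0n // -natrM.
have s6 : Num.sqrt 6 ^+ 2 = 6 :> R by rewrite sqr_sqrtr ?ler0n.
have s0 : Num.sqrt 6 != 0 :> R by rewrite sqrtr_eq0 -ltNge ltr0n.
have -> : (Num.sqrt 6)^-1 = Num.sqrt 6 / 6 :> R.
  by apply: (mulfI s0); rewrite mulfV // mulrA -expr2 s6 mulfV // pnatr_eq0.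
by field.
Qed.

Lemma deficit12 : deficit 1 2 = 3 / 2 - Num.sqrt 2.
Proof.
rewrite /deficit sqrrB !inv_sqrt_sqr /inv_sqrt sqrtr1 invr1 mul1r.
have s2 : Num.sqrt 2 ^+ 2 = 2 :> R by rewrite sqr_sqrtr ?ler0n.
have s0 : Num.sqrt 2 != 0 :> R by rewrite sqrtr_eq0 -ltNge ltr0n.
have -> : (Num.sqrt 2)^-1 = Num.sqrt 2 / 2 :> R.
  by apply: (mulfI s0); rewrite mulfV // mulrA -expr2 s2 mulfV // pnatr_eq0.
by field.
Qed.

Lemma deficit23_gt0 : 0 < deficit 2 3.
Proof.
rewrite lt_neqAle deficit_ge0 andbT eq_sym; apply/eqP => e.
by have := @deficit_eq0 2 3 isT isT e.
Qed.

Lemma deficit23_lt_deficit12 : 4 * deficit 2 3 < deficit 1 2.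
Proof.
rewrite deficit23 deficit12.
have s2 : Num.sqrt 2 ^+ 2 = 2 :> R by rewrite sqr_sqrtr ?ler0n.
have s6 : Num.sqrt 6 ^+ 2 = 6 :> R by rewrite sqr_sqrtr ?ler0n.
have p2 : 0 <= Num.sqrt 2 :> R by exact: sqrtr_ge0.
have p6 : 0 <= Num.sqrt 6 :> R by exact: sqrtr_ge0.
(* With these decimal bounds [4 * deficit 2 3] is below 0.068 and [deficit 1 2] is above 0.085. *)
have b2 : Num.sqrt 2 < 1415 / 1000 :> R by nra.
have b6 : 2449 / 1000 < Num.sqrt 6 :> R by nra.
lra.
Qed.

Lemma randic_deficit (G : sgraph) : (forall u : G, 0 < degree u)%N ->
  randic R G = 1 / 2 * #|G|%:R
    - 1 / 4 * \sum_(p : G * G | adj p.1 p.2) deficit (degree p.1) (degree p.2).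
Proof.
move=> d0.
have main : randic R G *+ 2 =
    \sum_(p : G * G | adj p.1 p.2) inv_sqrt (degree p.1) * inv_sqrt (degree p.2).
  rewrite /randic -sum_arcs_edges; apply: eq_bigr => -[u v] /= /adj_neq uv.
  rewrite big_setU1 ?inE //= big_set1 sqrtrM ?ler0n //.
  by rewrite mul1r invfM.
(* Each vertex u starts deg(u) arcs of weight 1/deg(u), hence contributes exactly 1; this uses that
   degrees are positive. *)
have diag : \sum_(p : G * G | adj p.1 p.2) inv_sqrt (degree p.1) ^+ 2 = #|G|%:R :> R.
  rewrite (sum_arcs_fst (fun u => inv_sqrt (degree u) ^+ 2)) -sum1_card natr_sum.
  apply: eq_bigr => u _; rewrite inv_sqrt_sqr -[LHS]mulr_natr mulVf //.
  by rewrite pnatr_eq0 -lt0n.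
have diag' := diag.
rewrite (sum_arcs_sym (fun u _ => inv_sqrt (degree u) ^+ 2)) in diag'.
have -> : \sum_(p : G * G | adj p.1 p.2) deficit (degree p.1) (degree p.2)
    = #|G|%:R + #|G|%:R - (randic R G *+ 2) *+ 2.
  rewrite main -{1}diag -diag' -sumrMnl -big_split -sumrB /=.
  by apply: eq_bigr => p _; rewrite /deficit; ring.
by field.
Qed.

End RandicDeficit.

(** * Parity of a cut *)

Lemma sum_arcs_fst_nat (G : sgraph) (F : G -> nat) :
  (\sum_(p : G * G | adj p.1 p.2) F p.1 = \sum_(u : G) F u * degree u)%N.
Proof.
have := sum_arcs_fst F => ->; apply: eq_bigr => u _.
by rewrite -mulr_natr natn.
Qed.

(** The degree sum over [P] counts the arcs that start in [P]. Those that stay in [P] come in pairs,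
    two per edge inside [P], so only the leaving arcs affect the parity. *)
Lemma odd_cut (G : sgraph) (P : pred G) :
  odd (\sum_(p : G * G | adj p.1 p.2) (P p.1 && ~~ P p.2)) = odd (\sum_(u | P u) degree u).
Proof.
have inside := sum_arcs_edges (fun e : {set G} => nat_of_bool (e \subset [set u | P u])).
rewrite nat_mulr2n in inside.
have -> : (\sum_(u | P u) degree u = \sum_(u : G) P u * degree u)%N.
  by rewrite big_mkcond; apply: eq_bigr => u _; case: (P u); rewrite ?mul1n ?mul0n.
rewrite -sum_arcs_fst_nat.
have -> : (\sum_(p : G * G | adj p.1 p.2) P p.1 =
    \sum_(p : G * G | adj p.1 p.2) ([set p.1; p.2] \subset [set u | P u])
    + \sum_(p : G * G | adj p.1 p.2) (P p.1 && ~~ P p.2))%N.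
  rewrite -big_split; apply: eq_bigr => -[u v] _ /=.
  rewrite subUset !sub1set !inE.
  by case: (P u); case: (P v).
have -> : (\sum_(p : G * G | adj p.1 p.2) ([set p.1; p.2] \subset [set u | P u]) =
   (\sum_(e in edges G) (e \subset [set u | P u])) * 2)%N := inside.
by rewrite oddD oddM andbF.
Qed.

(** * Graphs whose degrees are all 2 or 3 *)

Definition deg23 (G : sgraph) := forall u : G, (degree u == 2%N) || (degree u == 3%N).

(** With [n2] and [n3] the numbers of vertices of degree 2 and 3, the last two equations count in
    two ways the arcs that start at such vertices: an edge within a class gives two of them, a mixed
    edge one. *)
Lemma deg23_counts (G : sgraph) : deg23 G -> exists n2 n3 : nat,
  [/\ (n2 + n3 = #|G|)%N,
      (n2 * 2 = edge_count G 2 2 * 2 + edge_count G 2 3)%N &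
      (n3 * 3 = edge_count G 3 3 * 2 + edge_count G 2 3)%N].
Proof.
move=> d23; exists (\sum_(u : G) (degree u == 2))%N, (\sum_(u : G) (degree u == 3))%N.
have cross : (\sum_(p : G * G | adj p.1 p.2) ((degree p.1 == 2) && (degree p.2 == 3)) =
    \sum_(p : G * G | adj p.1 p.2) ((degree p.1 == 3) && (degree p.2 == 2)))%N.
  have := sum_arcs_sym (fun u v : G => nat_of_bool ((degree u == 2) && (degree v == 3))).
  by move=> e; etransitivity; [exact: e|apply: eq_bigr => p _; rewrite andbC].
have m23 := edge_count_arcs G 2 3.
have {}m23 : (edge_count G 2 3 * 2 =
    \sum_(p : G * G | adj p.1 p.2) ((degree p.1 == 2) && (degree p.2 == 3))
    + \sum_(p : G * G | adj p.1 p.2) ((degree p.1 == 3) && (degree p.2 == 2)))%N.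
  rewrite m23 -big_split; apply: eq_bigr => p _ /=.
  by case/orP: (d23 p.1) => /eqP ->; case/orP: (d23 p.2) => /eqP ->.
split.
- rewrite -big_split -sum1_card; apply: eq_bigr => u _ /=.
  by case/orP: (d23 u) => /eqP ->.
- rewrite big_distrl edge_count_arcs /=.
  have -> : (edge_count G 2 3 =
    \sum_(p : G * G | adj p.1 p.2) ((degree p.1 == 2) && (degree p.2 == 3)))%N by lia.
  rewrite -big_split /=.
  transitivity (\sum_(u : G) (degree u == 2) * degree u)%N.
    by apply: eq_bigr => u _; case: eqP => [->|].
  rewrite -(sum_arcs_fst_nat (fun u : G => nat_of_bool (degree u == 2))).
  apply: eq_bigr => p _ /=.
  by case/orP: (d23 p.1) => /eqP ->; case/orP: (d23 p.2) => /eqP ->.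
- rewrite big_distrl edge_count_arcs /=.
  have -> : (edge_count G 2 3 =
    \sum_(p : G * G | adj p.1 p.2) ((degree p.1 == 3) && (degree p.2 == 2)))%N by lia.
  rewrite -big_split /=.
  transitivity (\sum_(u : G) (degree u == 3) * degree u)%N.
    by apply: eq_bigr => u _; case: eqP => [->|].
  rewrite -(sum_arcs_fst_nat (fun u : G => nat_of_bool (degree u == 3))).
  apply: eq_bigr => p _ /=.
  by case/orP: (d23 p.1) => /eqP ->; case/orP: (d23 p.2) => /eqP ->.
Qed.

Lemma edges_deg23 (G : sgraph) : deg23 G ->
  #|edges G| = (edge_count G 2 2 + edge_count G 2 3 + edge_count G 3 3)%N.
Proof.
move=> d23; suff : (#|edges G| * 2 =
  edge_count G 2 2 * 2 + edge_count G 2 3 * 2 + edge_count G 3 3 * 2)%N by lia.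
rewrite !edge_count_arcs -!big_split /= -sum_degree.
transitivity (\sum_(u : G) 1 * degree u)%N; first by apply: eq_bigr => u _; rewrite mul1n.
rewrite -(sum_arcs_fst_nat (fun=> 1%N)); apply: eq_bigr => p _.
by case/orP: (d23 p.1) => /eqP ->; case/orP: (d23 p.2) => /eqP ->.
Qed.

(** The three classes of arcs are disjoint, so if their sizes add up to the number of all arcs,
    every arc lies in one of them. Positive degree puts every vertex on an arc. *)
Lemma deg23_of_edge_counts (G : sgraph) : (forall u : G, 0 < degree u)%N ->
  #|edges G| = (edge_count G 2 2 + edge_count G 2 3 + edge_count G 3 3)%N -> deg23 G.
Proof.
move=> d0 hE u.
pose S (p : G * G) : nat :=
  (((degree p.1 == 2) && (degree p.2 == 2) || (degree p.1 == 2) && (degree p.2 == 2))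
  + ((degree p.1 == 2) && (degree p.2 == 3) || (degree p.1 == 3) && (degree p.2 == 2))
  + ((degree p.1 == 3) && (degree p.2 == 3) || (degree p.1 == 3) && (degree p.2 == 3)))%N.
have S1 (p : G * G) : (S p <= 1)%N by rewrite /S; lia.
have hS : (\sum_(p : G * G | adj p.1 p.2) S p = \sum_(p : G * G | adj p.1 p.2) 1)%N.
  rewrite (sum_arcs_fst_nat (fun=> 1%N)).
  transitivity (#|edges G| * 2)%N; last first.
    by rewrite -sum_degree; apply: eq_bigr => v _; rewrite mul1n.
  by rewrite hE !mulnDl !edge_count_arcs -!big_split; apply: eq_bigr.
have [v uv] : exists v : G, adj u v.
  by have := d0 u; rewrite card_gt0 => /set0Pn [v]; rewrite inE => ?; exists v.
have : S (u, v) = 1%N.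
  apply/eqP; move: hS; rewrite (bigD1 (u, v)) //= [in RHS](bigD1 (u, v)) //=.
  have : (\sum_(i : G * G | adj i.1 i.2 && (i != (u, v))) S i
     <= \sum_(i : G * G | adj i.1 i.2 && (i != (u, v))) 1)%N by apply: leq_sum.
  have := S1 (u, v).
  set a := S _; set b := (\sum_(_ | _) S _)%N; set c := (\sum_(_ | _) 1)%N; lia.
by rewrite /S /=; lia.
Qed.

Lemma Lambda1P (k n : nat) (G : sgraph) :
  #|G| = n -> has_cyclomatic_number G k -> (forall u : G, 0 < degree u)%N ->
  Lambda1 k n G <-> deg23 G /\ edge_count G 2 3 = 2%N.
Proof.
rewrite /has_cyclomatic_number => hn hcyc d0; split => [[_ m33 m23 m22]|[d23 m23]].
  (* The prescribed counts add up to (3k-4) + 2 + (n-2k+1) = n+k-1, the number of all edges. *)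
  have hE : #|edges G| = (edge_count G 2 2 + edge_count G 2 3 + edge_count G 3 3)%N by lia.
  by split; [exact: deg23_of_edge_counts|lia].
have [n2 [n3 [hN h2 h3]]] := deg23_counts d23.
have hE := edges_deg23 d23.
(* With two mixed edges, the vertex and edge counts form a linear system that forces n3 = 2k-2 and
   n2 = n-2k+2. *)
by split; lia.
Qed.

(** * Lower bounds for the total deficit *)

Section DeficitBound.

Variable R : rcfType.

Let D (G : sgraph) : R :=
  \sum_(p : G * G | adj p.1 p.2) deficit R (degree p.1) (degree p.2).

Lemma sum_deficit_deg23 (G : sgraph) : deg23 G ->
  D G = deficit R 2 3 * (edge_count G 2 3)%:R *+ 2.
Proof.
move=> d23; rewrite -mulrnAr -mulrnA edge_count_arcs natr_sum mulr_sumr.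
apply: eq_bigr => p _.
case/orP: (d23 p.1) => /eqP ->; case/orP: (d23 p.2) => /eqP -> /=;
  by rewrite ?deficitii ?mulr0 ?mulr1 // deficit_sym.
Qed.

Lemma sum_deficit_leaf (G : sgraph) (a b : G) :
  connected_graph G -> degree a = 1%N -> (1 < degree b)%N -> 4 * deficit R 2 3 < D G.
Proof.
move=> conn a1 b1; have G1 : (1 < #|G|)%N.
  by apply/card_gt1P; exists a, b; split => //; apply: contraTneq b1 => <-; rewrite a1.
have [||u [v [uv /eqP u1 v1]]] := @connected_cut G (fun u => degree u == 1%N) a b conn.
- by rewrite a1.
- by rewrite gtn_eqF.
have v2 : (2 <= degree v)%N by have := connected_degree_gt0 v conn G1; lia.
(* A single orientation of the edge from the leaf [u] suffices, since its deficit is at least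
   [deficit 1 2]. *)
apply: lt_le_trans (deficit23_lt_deficit12 R) _.
rewrite /D (bigD1 (u, v)) //= u1.
by rewrite ler_wpDr ?sumr_ge0 // => [p _|]; [exact: deficit_ge0|exact: ler_deficit].
Qed.

Section MinDegreeTwo.

Variables (G : sgraph) (a b : G).
Hypotheses (conn : connected_graph G) (deg2 : forall u : G, (2 <= degree u)%N).
Hypotheses (a2 : degree a = 2%N) (b3 : (2 < degree b)%N).

(** Oriented away from degree 2, so that [c] counts each crossing edge once and its parity is the
    one given by [odd_cut]. *)
Let cut (u v : G) := (degree u == 2%N) && (degree v != 2%N).

Let c := (\sum_(p : G * G | adj p.1 p.2) cut p.1 p.2)%N.

Lemma cut_ge2 : (2 <= c)%N.
Proof.
have c_even : ~~ odd c.
  rewrite /c (odd_cut (fun u : G => degree u == 2%N)).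
  rewrite (eq_bigr (fun=> 2%N)) => [|u /eqP //].
  by rewrite sum_nat_const oddM andbF.
have [||u [v [uv hu hv]]] := @connected_cut G (fun u => degree u == 2%N) a b conn.
- by rewrite a2.
- by rewrite gtn_eqF.
suff : (0 < c)%N by case: (c) c_even => [|[|]].
by rewrite /c (bigD1 (u, v)) //= /cut hu hv.
Qed.

(** Each orientation of a crossing edge is charged [deficit R 2 3], all other arcs nothing; the
    slack is the deficit left after the charge. The total charge is thus [2 * c] times
    [deficit R 2 3]. *)
Let slack (p : G * G) : R := deficit R (degree p.1) (degree p.2)
  - deficit R 2 3 * (cut p.1 p.2 + cut p.2 p.1)%:R.

(** A crossing edge joins degree 2 to degree at least 3, and the deficit grows with the distance
    from 2. Other arcs bear no charge. *)
Lemma slack_ge0 (p : G * G) : 0 <= slack p.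
Proof.
have h1 := deg2 p.1; have h2 := deg2 p.2.
rewrite /slack /cut subr_ge0.
case: (eqVneq (degree p.1) 2%N) => [->|n1]; case: (eqVneq (degree p.2) 2%N) => [->|n2] /=;
  rewrite ?addn0 ?add0n ?mulr0 ?mulr1 ?deficit_ge0 //.
  by apply: ler_deficit; lia.
by rewrite [leRHS]deficit_sym; apply: ler_deficit; lia.
Qed.

Lemma sum_slack : \sum_(p : G * G | adj p.1 p.2) slack p = D G - deficit R 2 3 * c%:R *+ 2.
Proof.
rewrite sumrB -mulr_sumr -natr_sum big_split /=; congr (_ - _).
rewrite -(sum_arcs_sym (fun u v : G => nat_of_bool (cut u v))) natrD mulrDr.
by rewrite mulr2n.
Qed.

Lemma sum_deficit_ge : 4 * deficit R 2 3 <= D G.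
Proof.
have h : 0 <= D G - deficit R 2 3 * c%:R *+ 2.
  by rewrite -sum_slack sumr_ge0 // => p _; exact: slack_ge0.
have q0 := deficit23_gt0 R.
have c2 : 2 <= c%:R :> R by rewrite ler_nat cut_ge2.
nra.
Qed.

(** Equality makes every slack vanish. Then every neighbour of a vertex of degree 2 or 3 again has
    degree 2 or 3, and this spreads from [a] over the connected graph. *)
Lemma sum_deficit_eq : D G = 4 * deficit R 2 3 -> deg23 G.
Proof.
move=> hD; have q0 := deficit23_gt0 R.
have c2 : 2 <= c%:R :> R by rewrite ler_nat cut_ge2.
have h0 : \sum_(p : G * G | adj p.1 p.2) slack p = 0.
  apply/eqP; rewrite eq_le sumr_ge0 ?andbT => [|p _]; last exact: slack_ge0.
  by rewrite sum_slack hD; nra.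
have tight (u v : G) : adj u v -> slack (u, v) = 0.
  by move=> uv; apply: (psumr_eq0P _ h0) => // p _; exact: slack_ge0.
apply: (connected_invariant conn (a := a)); last by rewrite a2.
move=> u v uv hu; have := tight u v uv; have v2 := deg2 v.
rewrite /slack /cut /=; case/orP: hu => /eqP ->.
  case: (eqVneq (degree v) 2%N) => //= nv /eqP.
  rewrite addn0 mulr1 subr_eq0 => /eqP e; apply/eqP.
  by apply: (deficit_inj (R := R) (i := 2)) e; lia.
(* An uncharged arc from degree 3 has deficit zero, so its other end has degree 3. *)
case: (eqVneq (degree v) 2%N) => //= nv.
by rewrite addn0 mulr0 subr0 => /deficit_eq0 <- //; lia.
Qed.

End MinDegreeTwo.

Lemma sum_deficit_eq0 (G : sgraph) : connected_graph G -> (forall u : G, 0 < degree u)%N ->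
  D G = 0 -> forall u v : G, degree u = degree v.
Proof.
move=> conn d0 hD u v; apply/eqP; rewrite eq_sym; move: v.
apply: (connected_invariant conn (a := u)) => // x y xy /eqP <-.
rewrite eq_sym; apply/eqP/(@deficit_eq0 R) => //.
by apply: (psumr_eq0P _ hD (i := (x, y))) => // p _; exact: deficit_ge0.
Qed.

End DeficitBound.

(** * Both ranges of n, by way of the average degree *)

Theorem theorem2p8 (R : rcfType) (k n : nat) (G : sgraph)
    (hk : (3 <= k)%N) (hn : #|G| = n)
    (hconn : connected_graph G) (hcyc : has_cyclomatic_number G k) :
  ((2 * k - 1 <= n)%N ->
     randic R G <= 1 / 2 * n%:R - (5 - 2 * Num.sqrt 6) / 6 /\
     (randic R G = 1 / 2 * n%:R - (5 - 2 * Num.sqrt 6) / 6 <-> Lambda1 k n G)) /\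
  (n = (2 * k - 2)%N ->
     randic R G <= 1 / 2 * n%:R /\
     (randic R G = 1 / 2 * n%:R <-> regular G 3)).
Proof.
have hdeg : (\sum_(u : G) degree u = (n + k - 1) * 2)%N.
  by rewrite sum_degree; move: hcyc; rewrite /has_cyclomatic_number; lia.
have hconst d : (\sum_(u : G) d = n * d)%N by rewrite sum_nat_const hn.
split=> hnk.
- have G1 : (1 < #|G|)%N by lia.
  have d0 u := connected_degree_gt0 u hconn G1.
  rewrite (randic_deficit R d0) hn -deficit23.
  set D := \sum_(p : G * G | _) _.
  (* Otherwise 3n is at most 2(n+k-1), that is, n is at most 2k-2. *)
  have [a ha] : exists a : G, (degree a <= 2)%N.
    apply/existsP; apply: contraT => /existsPn h.
    have : (\sum_(u : G) 3 <= \sum_(u : G) degree u)%N.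
      by apply: leq_sum => u _; have := h u; lia.
    by rewrite hconst hdeg; lia.
  (* Otherwise 2(n+k-1) is at most 2n, which contradicts k >= 3. *)
  have [b hb] : exists b : G, (2 < degree b)%N.
    apply/existsP; apply: contraT => /existsPn h.
    have : (\sum_(u : G) degree u <= \sum_(u : G) 2)%N.
      by apply: leq_sum => u _; have := h u; lia.
    by rewrite hconst hdeg; lia.
  have [hD hDeq] : 4 * deficit R 2 3 <= D /\ (D = 4 * deficit R 2 3 -> deg23 G).
    case: (boolP [exists u : G, degree u == 1%N]) => [/existsP [u /eqP u1]|/existsPn no1].
      have lt := sum_deficit_leaf R hconn u1 (ltnW hb).
      by split => [|e]; [exact: ltW|move: lt; rewrite -/D e ltxx].
    have deg2 (u : G) : (2 <= degree u)%N by have := d0 u; have := no1 u; lia.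
    have a2 : degree a = 2%N by have := deg2 a; lia.
    by split; [exact: sum_deficit_ge a2 hb|exact: sum_deficit_eq a2 hb].
  split; first by lra.
  rewrite (Lambda1P hn hcyc d0); split => [e|[d23 m23]].
    have d23 : deg23 G by apply: hDeq; lra.
    split => //; have := sum_deficit_deg23 R d23; rewrite -/D.
    (* Both expressions for [D] are multiples of the positive [deficit R 2 3]; cancelling it leaves
       [edge_count G 2 3 = 2]. *)
    have -> : D = deficit R 2 3 * 2%:R *+ 2 by lra.
    rewrite -!mulrnAr => /(mulfI (lt0r_neq0 (deficit23_gt0 R))) /eqP.
    by rewrite -!mulrnA eqr_nat; lia.
  have := sum_deficit_deg23 R d23; rewrite -/D m23; lra.
- have G1 : (1 < #|G|)%N by lia.
  have d0 u := connected_degree_gt0 u hconn G1.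
  rewrite (randic_deficit R d0) hn.
  set D := \sum_(p : G * G | _) _.
  have D0 : 0 <= D by apply: sumr_ge0 => p _; exact: deficit_ge0.
  split; first by lra.
  split => [e|reg].
    have hD : D = 0 by lra.
    have same := sum_deficit_eq0 hconn d0 hD.
    move=> u; have : (\sum_(v : G) degree v = \sum_(v : G) degree u)%N.
      by apply: eq_bigr => v _; exact: same.
    (* For a constant degree d this reads nd = 2(n+k-1), which is 3n when n = 2k-2; since n > 0, d =
       3. *)
    by rewrite hconst hdeg; nia.
  have -> : D = 0 by apply: big1 => p _; rewrite !reg deficitii.
  by rewrite mulr0 subr0.
Qed.
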